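(* Let $L$ be an infinitely distributive lattice and let $Y\subseteq L$ be a sublattice satisfying Properties (A) and (B). Then $Y_1^{\mathfrak{u}O}=Y_1^{O}$, and both are simultaneously O-closed and $\mathfrak{u}$O-closed.
   Context: A sublattice of $L$ is a subset closed under the binary joins and meets of $L$. For $A\subseteq L$, $A^{+}$ and $A^{-}$ are the sets of upper and lower bounds of $A$ in $L$. $Y$ has Property (A) if for every $A\subseteq Y$ and every $x\in A^{-}$ there exists $y\in A^{-}\cap Y$ with $x\le y$. $Y$ has Property (B) if for every $A\subseteq Y$ and every $x\in A^{+}$ there exists $y\in A^{+}\cap Y$ with $x\ge y$. A subset of a poset is directed (resp. filtered) if it is non-empty and each of its finite subsets has an upper bound (resp. lower bound) in it. A net $(x_\gamma)_{\gamma\in\Gamma}$ in $L$ O-converges to $x\in L$ if there exist a directed set $M\subseteq L$ and a filtered set $N\subseteq L$ with $\bigvee M=\bigwedge N=x$ such that for every $(m,n)\in M\times N$ there is $\gamma_0\in\Gamma$ with $m\le x_\gamma\le n$ for all $\gamma\ge\gamma_0$. The net $\mathfrak{u}$O-converges to $x$ if $((x_\gamma\wedge t)\vee s)_{\gamma\in\Gamma}$ O-converges to $(x\wedge t)\vee s$ for every $s,t\in L$ with $s\le t$. A lattice $L$ is infinitely distributive if for every $x\in L$ and every family $\{x_\alpha\}_{\alpha\in\mathcal A}\subseteq L$: whenever $\bigwedge_\alpha x_\alpha$ exists, $x\vee\bigwedge_\alpha x_\alpha=\bigwedge_\alpha(x\vee x_\alpha)$; and whenever $\bigvee_\alpha x_\alpha$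 exists, $x\wedge\bigvee_\alpha x_\alpha=\bigvee_\alpha(x\wedge x_\alpha)$. For $X\subseteq L$, $X_1^{O}$ (resp. $X_1^{\mathfrak{u}O}$) is the set of all $x\in L$ for which there is a net in $X$ that O-converges (resp. $\mathfrak{u}$O-converges) to $x$. $X$ is O-closed (resp. $\mathfrak{u}$O-closed) if $X=X_1^{O}$ (resp. $X=X_1^{\mathfrak{u}O}$). *)

(* Defs.v *)
From mathcomp Require Import all_boot all_order.
From mathcomp Require Import boolp classical_sets functions cardinality.

Set Implicit Arguments.
Unset Strict Implicit.
Unset Printing Implicit Defensive.

Local Open Scope classical_set_scope.
Local Open Scope order_scope.

(* Upper and lower bounds, least upper bounds and greatest lower bounds are
   those of classical_sets: [supremums A x] (resp. [infimums A x]) says that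
   the supremum (resp. infimum) of A exists and equals x. *)

Section Lattice.
Context {d : Order.disp_t} {L : latticeType d}.
Implicit Types (X Y M N A F : set L) (x y m n s t : L).

Definition sublattice Y :=
  forall x y, Y x -> Y y -> Y (Order.meet x y) /\ Y (Order.join x y).

(* A ranges over all subsets of Y, including the empty one. *)
Definition propertyA Y :=
  forall A, A `<=` Y -> forall x, lbound A x ->
    exists y, [/\ lbound A y, Y y & x <= y].

Definition propertyB Y :=
  forall A, A `<=` Y -> forall x, ubound A x ->
    exists y, [/\ ubound A y, Y y & y <= x].

Definition directed_subset M :=
  M !=set0 /\
  forall F, F `<=` M -> finite_set F -> exists2 u, M u & ubound F u.

Definition filtered_subset N :=
  N !=set0 /\
  forall F, F `<=` N -> finite_set F -> exists2 l, N l & lbound F l.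

End Lattice.

Definition infinitely_distributive d (L : latticeType d) :=
  forall (x : L) (I : Type) (f : I -> L),
    (forall y, infimums (range f) y ->
       infimums (range (fun i => Order.join x (f i))) (Order.join x y)) /\
    (forall y, supremums (range f) y ->
       supremums (range (fun i => Order.meet x (f i))) (Order.meet x y)).

(* Index sets of nets: nonempty preordered types in which any two elements
   have an upper bound; antisymmetry is not required. *)
Record directedType := DirectedType {
  dir_sort :> Type;
  dir_le : dir_sort -> dir_sort -> Prop;
  dir_inhabited : inhabited dir_sort;
  dir_refl : forall i, dir_le i i;
  dir_trans : forall i j k, dir_le i j -> dir_le j k -> dir_le i k;
  dir_ub : forall i j, exists k, dir_le i k /\ dir_le j k }.

Section Convergence.
Context {d : Order.disp_t} {L : latticeType d}.
Implicit Types (X : set L) (x : L).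

Definition O_cvg (I : directedType) (u : I -> L) x :=
  exists M N : set L,
    [/\ directed_subset M, filtered_subset N, supremums M x, infimums N x &
      forall m n, M m -> N n ->
        exists i0, forall i, dir_le i0 i -> m <= u i /\ u i <= n].

Definition uO_cvg (I : directedType) (u : I -> L) x :=
  forall s t : L, s <= t ->
    O_cvg (fun i => Order.join (Order.meet (u i) t) s)
          (Order.join (Order.meet x t) s).

Definition O_adherence X : set L :=
  [set x | exists (I : directedType) (u : I -> L),
             (forall i, X (u i)) /\ O_cvg u x].

Definition uO_adherence X : set L :=
  [set x | exists (I : directedType) (u : I -> L),
             (forall i, X (u i)) /\ uO_cvg u x].

Definition O_closed X := X = O_adherence X.

Definition uO_closed X := X = uO_adherence X.

End Convergence.

(* Main.v *)
Require Import Defs.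
From mathcomp Require Import all_boot all_order.
From mathcomp Require Import boolp classical_sets.

(** Properties (A) and (B) make [Y] itself closed: the theorem holds because
    [O_adherence Y = Y = uO_adherence Y].

    Let a net [u] in [Y] O-converge to [x], with [M] directed, [N] filtered and
    [sup M = inf N = x].  A bound [m] in [M] lies below a tail of [u]; since
    that tail is a subset of [Y], Property (A) improves [m] to an element of
    [Y] that is still below the tail, and hence below [x] because the net is
    eventually below every [n] in [N] ([O_cvg_lower_approx]).  The elements of
    [Y] below [x] therefore dominate [M], so [x] is their supremum.
    Property (B), applied to the set of these elements and to its upper bound
    [x], gives an upper bound in [Y] that is at most [x]: it can only be [x]
    itself ([O_adherence_id]).

    For unbounded order convergence, Properties (A) and (B) for the empty set
    provide [s <= x <= t] with [s] and [t] in [Y].  Truncating the net between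
    [s] and [t] keeps it in the sublattice [Y] and makes it O-converge to
    [(x /\ t) \/ s = x], which is the previous case ([uO_sub_O_adherence]). *)

Set Implicit Arguments.
Unset Strict Implicit.
Unset Printing Implicit Defensive.

Import Order.TTheory.
Local Open Scope classical_set_scope.
Local Open Scope order_scope.

Definition unit_directed : directedType :=
  @DirectedType unit (fun _ _ => True) (inhabits tt) (fun _ => I)
    (fun _ _ _ _ _ => I) (fun _ _ => ex_intro _ tt (conj I I)).

Section Adherence.
Context {d : Order.disp_t} {L : latticeType d}.
Implicit Types (X Y : set L) (x s t : L).

Lemma O_cvg_cst (I : directedType) x : O_cvg (fun _ : I => x) x.
Proof.
have [i0] := dir_inhabited I.
exists [set x], [set x]; split.
- by split=> [|F Fx _]; exists x => // y /Fx ->.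
- by split=> [|F Fx _]; exists x => // y /Fx ->.
- by split=> [y -> //|y]; apply.
- by split=> [y -> //|y]; apply.
- by move=> m n -> ->; exists i0.
Qed.

Lemma sub_O_adherence X : X `<=` O_adherence X.
Proof.
by move=> x Xx; exists unit_directed, (fun=> x); split=> //; apply: O_cvg_cst.
Qed.

Lemma sub_uO_adherence X : X `<=` uO_adherence X.
Proof.
move=> x Xx; exists unit_directed, (fun=> x); split=> // s t _.
exact: O_cvg_cst.
Qed.

(** Property (A) turns the lower bounds witnessing O-convergence, which are
    arbitrary elements of [L], into elements of [Y]. *)
Lemma O_cvg_lower_approx Y (I : directedType) (u : I -> L) x :
  propertyA Y -> (forall i, Y (u i)) -> O_cvg u x ->
  lbound (ubound [set y | Y y /\ y <= x]) x.
Proof.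
move=> YA Yu [M [N [_ [[n0 Nn0] _] [_ Mlub] [_ Nglb] MN]]] z zub.
apply: Mlub => m Mm; have [i0 ui0] := MN _ _ Mm Nn0.
pose tail := [set u i | i in [set i | dir_le i0 i]].
have tailY : tail `<=` Y by move=> _ [i _ <-].
have mtail : lbound tail m by move=> _ [i /ui0[mu _] <-].
have [y [ytail Yy my]] := YA _ tailY _ mtail.
apply: (le_trans my); apply: zub; split=> //.
apply: Nglb => n Nn; have [i1 ui1] := MN _ _ Mm Nn.
have [k [i0k i1k]] := dir_ub i0 i1.
by apply: (@le_trans _ _ (u k)); [apply: ytail; exists k | case: (ui1 k i1k)].
Qed.

Lemma O_adherence_id Y : propertyA Y -> propertyB Y -> O_adherence Y = Y.
Proof.
move=> YA YB; apply/seteqP; split; last exact: sub_O_adherence.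
move=> x [I [u [Yu ux]]]; pose below := [set y | Y y /\ y <= x].
have belowY : below `<=` Y by move=> y [].
have xub : ubound below x by move=> y [].
have [y [yub Yy yx]] := YB _ belowY _ xub.
have xy : x <= y by apply: (O_cvg_lower_approx YA Yu ux).
by rewrite (le_anti (introT andP (conj xy yx))).
Qed.

Lemma uO_sub_O_adherence Y :
  sublattice Y -> propertyA Y -> propertyB Y ->
  uO_adherence Y `<=` O_adherence Y.
Proof.
move=> Ylat YA YB x [I [u [Yu ux]]].
have [t [_ Yt xt]] : exists t, [/\ lbound set0 t, Y t & x <= t].
  by apply: YA => [? []|? []].
have [s [_ Ys sx]] : exists s, [/\ ubound set0 s, Y s & s <= x].
  by apply: YB => [? []|? []].
exists I, (fun i => Order.join (Order.meet (u i) t) s); split=> [i|].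
  by apply: (Ylat _ _ _ Ys).2; apply: (Ylat _ _ (Yu i) Yt).1.
by have := ux s t (le_trans sx xt); rewrite (meet_l xt) (join_l sx).
Qed.

Lemma uO_adherence_id Y :
  sublattice Y -> propertyA Y -> propertyB Y -> uO_adherence Y = Y.
Proof.
move=> Ylat YA YB; apply/seteqP; split; last exact: sub_uO_adherence.
by rewrite -{2}(O_adherence_id YA YB); apply: uO_sub_O_adherence.
Qed.

End Adherence.

Theorem theorem30 (d : Order.disp_t) (L : latticeType d) (Y : set L) :
  infinitely_distributive L ->
  sublattice Y -> propertyA Y -> propertyB Y ->
  uO_adherence Y = O_adherence Y /\
  (O_closed (uO_adherence Y) /\ uO_closed (uO_adherence Y)) /\
  (O_closed (O_adherence Y) /\ uO_closed (O_adherence Y)).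
Proof.
move=> _ Ylat YA YB; have OY := O_adherence_id YA YB.
have uOY := uO_adherence_id Ylat YA YB.
by rewrite /O_closed /uO_closed !(OY, uOY).
Qed.
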